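(* Let $\vartheta\in[0,1)$ and let $$\Delta\tau_{\mathrm{OPT}}(\vartheta)=\arg\min_{\Delta\tau>0}\ \sup_{\pi/2<\alpha<\pi}\left|G(\alpha,\vartheta,\Delta\tau)\right|$$ be the optimal relaxation parameter for Dirichlet boundary conditions in 2D. Then $$\Delta\tau_{\mathrm{OPT}}(\vartheta)=\frac{2}{G_0(\pi/2,\vartheta)+G_0(\pi,\vartheta)}.$$
   Context: For $\alpha\in[0,\pi]$ put $p(\alpha)=\cosh^{-1}(2-\cos\alpha)$, where $\cosh^{-1}:[1,\infty)\to[0,\infty)$ is the inverse of $\cosh$ on $[0,\infty)$. For $\vartheta\in[0,1)$ define the Dirichlet coefficients $$c_{-2}(\vartheta)=\tfrac{\vartheta(\vartheta-1)}{2},\quad c_{-1}(\vartheta)=\vartheta(2-\vartheta),\quad c_0(\vartheta)=\tfrac{(1-\vartheta)(2-\vartheta)}{2},$$ and set $$G_0(\alpha,\vartheta)=\sum_{r=0}^{2}c_{-r}(\vartheta)\,e^{-r\,p(\alpha)},\qquad G(\alpha,\vartheta,\Delta\tau)=1-\Delta\tau\,G_0(\alpha,\vartheta)\quad(\Delta\tau>0).$$ ($G$ is the amplification factor of the tangential Fourier mode $e^{\mathbf{i}\alpha y/h}$ under one relaxation of the ghost values.) *)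

(* Defs.v *)
From Stdlib Require Import Reals Lra ClassicalEpsilon.
From Coquelicot Require Import Coquelicot.
Open Scope R_scope.

(* Total on [R], unspecified for x < 1; [arcosh_spec] and [arcosh_cosh] show that it is
   the inverse of [cosh : [0, oo) -> [1, oo)]. *)
Definition arcosh (x : R) : R :=
  epsilon (inhabits 0) (fun y => 0 <= y /\ cosh y = x).

Lemma cosh_onto (x : R) : 1 <= x -> exists y, 0 <= y /\ cosh y = x.
Proof.
intros hx.
assert (hs : 0 <= x * x - 1) by nra.
pose proof (sqrt_pos (x * x - 1)) as hp.
pose proof (sqrt_sqrt _ hs) as hq.
set (s := sqrt (x * x - 1)) in *.
exists (ln (x + s)); split.
- rewrite <- ln_1; apply ln_le; lra.
- unfold cosh; rewrite exp_Ropp, exp_ln by lra.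
  replace (/ (x + s)) with (x - s); [lra|].
  apply Rmult_eq_reg_l with (x + s); [|lra].
  rewrite Rinv_r by lra; nra.
Qed.

Lemma cosh_inj (x y : R) : 0 <= x -> 0 <= y -> cosh x = cosh y -> x = y.
Proof.
unfold cosh; rewrite !exp_Ropp; intros hx hy h.
assert (hX : 1 <= exp x)
  by (rewrite <- exp_0; destruct hx as [hx|<-]; [left; now apply exp_increasing|lra]).
assert (hY : 1 <= exp y)
  by (rewrite <- exp_0; destruct hy as [hy|<-]; [left; now apply exp_increasing|lra]).
apply exp_inv.
set (X := exp x) in *; set (Y := exp y) in *.
assert (h' : (X - Y) * (X * Y - 1) = 0).
{ replace ((X - Y) * (X * Y - 1))
    with (X * Y * ((X + / X) - (Y + / Y))) by (field; lra).
  replace (X + / X) with (Y + / Y) by lra; ring. }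
destruct (Rmult_integral _ _ h') as [h1|h1]; nra.
Qed.

Lemma arcosh_spec (x : R) : 1 <= x -> 0 <= arcosh x /\ cosh (arcosh x) = x.
Proof. intros hx; exact (epsilon_spec _ _ (cosh_onto x hx)). Qed.

Lemma arcosh_cosh (y : R) : 0 <= y -> arcosh (cosh y) = y.
Proof.
intros hy.
destruct (epsilon_spec (inhabits 0) (fun z => 0 <= z /\ cosh z = cosh y)) as [h0 h1].
- now exists y.
- now apply cosh_inj.
Qed.

Definition p (alpha : R) : R := arcosh (2 - cos alpha).

(* [dirichlet_coeff r theta] is c_{-r}(theta): the offset is stored negated. *)
Definition dirichlet_coeff (r : nat) (theta : R) : R :=
  match r with
  | 0%nat => (1 - theta) * (2 - theta) / 2
  | 1%nat => theta * (2 - theta)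
  | 2%nat => theta * (theta - 1) / 2
  | _ => 0
  end.

Definition G0 (alpha theta : R) : R :=
  sum_f_R0 (fun r => dirichlet_coeff r theta * exp (- INR r * p alpha)) 2.

Definition G (alpha theta dtau : R) : R := 1 - dtau * G0 alpha theta.

Definition sup_absG (theta dtau : R) : Rbar :=
  Lub_Rbar (fun v => exists alpha, PI / 2 < alpha < PI /\ v = Rabs (G alpha theta dtau)).

Definition is_argmin (D : R -> Prop) (f : R -> Rbar) (x : R) : Prop :=
  D x /\ forall y, D y -> Rbar_le (f x) (f y).

(* Main.v *)
Require Import Defs.
From Stdlib Require Import Reals Lra.
From Coquelicot Require Import Coquelicot.
Open Scope R_scope.

(** Write [x = exp (- p alpha)], the decay factor of the mode across one cell.
    Since [x] is the smaller root of [x + / x = 2 * (2 - cos alpha)], it is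
    [c - sqrt (c ^ 2 - 1)] with [c = 2 - cos alpha]; hence it is continuous in
    [alpha], and it decreases on [[0, PI]] because [c] increases there
    ([exp_opp_arcosh_antitone]).  The symbol [G0] is a quadratic polynomial in
    [x], positive and nondecreasing on [[0, 1]], so [G0] is continuous, positive
    and nonincreasing in [alpha].

    Put [A = G0 (PI / 2)] and [B = G0 PI], so that [0 < B <= A].  A function of
    the form [|1 - dtau * g|] is convex in [g], hence over the values of [G0] on
    the open interval it is bounded by its values at [A] and [B]; continuity
    makes the supremum equal to the larger of the two ([sup_absG_eq]).

    What remains is the classical Chebyshev problem of minimising
    [max (|1 - t * A|, |1 - t * B|)] ([minimax_two_points]).  The bounds
    [t * A - 1] and [1 - t * B] cross exactly at [t = 2 / (A + B)], where both
    equal [(A - B) / (A + B)]; away from that point one of them is strictly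
    larger. *)

(** * The decay factor *)

(** With [E = exp y] and [F = exp (- y)] one has [E + F = 2 * cosh y] and
    [E * F = 1], so [(E - F) / 2] is the nonnegative square root of
    [cosh y ^ 2 - 1]. *)
Lemma exp_opp_arcosh (c : R) :
  1 <= c -> exp (- arcosh c) = c - sqrt (c ^ 2 - 1).
Proof.
intros hc.
destruct (arcosh_spec c hc) as [h0 h1].
set (y := arcosh c) in *.
unfold cosh in h1.
assert (hEF : exp y * exp (- y) = 1)
  by (rewrite <- exp_plus, Rplus_opp_r; apply exp_0).
assert (hle : exp (- y) <= exp y).
{ destruct h0 as [h0|<-]; [left; apply exp_increasing; lra|].
  rewrite Ropp_0; lra. }
rewrite (sqrt_lem_1 (c ^ 2 - 1) ((exp y - exp (- y)) / 2)); nra.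
Qed.

(** The conjugate form [/ (c + sqrt (c ^ 2 - 1))] has an increasing
    denominator; multiplying out avoids the division. *)
Lemma exp_opp_arcosh_antitone (c d : R) :
  1 <= c <= d -> exp (- arcosh d) <= exp (- arcosh c).
Proof.
intros [hc hcd].
rewrite !exp_opp_arcosh by lra.
assert (hs : sqrt (c ^ 2 - 1) <= sqrt (d ^ 2 - 1)) by (apply sqrt_le_1; nra).
pose proof (sqrt_pos (c ^ 2 - 1)) as hc0.
assert (hc2 : 0 <= c ^ 2 - 1) by nra.
assert (hd2 : 0 <= d ^ 2 - 1) by nra.
pose proof (sqrt_sqrt _ hc2) as qc.
pose proof (sqrt_sqrt _ hd2) as qd.
set (s := sqrt (c ^ 2 - 1)) in *; set (t := sqrt (d ^ 2 - 1)) in *.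
apply Rmult_le_reg_l with ((c + s) * (d + t)); [nra|].
replace ((c + s) * (d + t) * (d - t)) with ((c + s) * (d * d - t * t)) by ring.
replace ((c + s) * (d + t) * (c - s)) with ((d + t) * (c * c - s * s)) by ring.
rewrite qc, qd; nra.
Qed.

Lemma exp_opp_arcosh_le_1 (c : R) : 1 <= c -> exp (- arcosh c) <= 1.
Proof.
intros hc; rewrite <- exp_0.
destruct (arcosh_spec c hc) as [[h|h] _].
- left; apply exp_increasing; lra.
- rewrite <- h, Ropp_0; lra.
Qed.

Lemma cosh_p_ge_1 (alpha : R) : 1 <= 2 - cos alpha.
Proof. destruct (COS_bound alpha); lra. Qed.

(** * The symbol of the boundary operator *)

Definition dirichlet_poly (theta x : R) : R :=
  (1 - theta) * (2 - theta) / 2 + theta * (2 - theta) * x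
  + theta * (theta - 1) / 2 * x ^ 2.

Lemma G0_eq (alpha theta : R) :
  G0 alpha theta = dirichlet_poly theta (exp (- p alpha)).
Proof.
unfold G0, dirichlet_poly; simpl.
replace (- 0 * p alpha) with 0 by ring.
replace (- (1) * p alpha) with (- p alpha) by ring.
replace (- (1 + 1) * p alpha) with (- p alpha + - p alpha) by ring.
rewrite exp_0, exp_plus; ring.
Qed.

(** The derivative [theta * (2 - theta) - theta * (1 - theta) * x] is at least
    [theta] for [x <= 1]; the factored difference quotient says the same. *)
Lemma dirichlet_poly_monotone (theta x y : R) :
  0 <= theta <= 1 -> x <= y <= 1 ->
  dirichlet_poly theta x <= dirichlet_poly theta y.
Proof.
intros ht hxy.
assert (hd : 0 <= (y - x) * (theta * ((2 - theta) - (1 - theta) * ((x + y) / 2)))).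
{ apply Rmult_le_pos; [lra|].
  apply Rmult_le_pos; [lra|nra]. }
unfold dirichlet_poly; nra.
Qed.

Lemma G0_pos (theta alpha : R) : 0 <= theta < 1 -> 0 < G0 alpha theta.
Proof.
intros ht; rewrite G0_eq.
apply Rlt_le_trans with (dirichlet_poly theta 0).
- unfold dirichlet_poly; nra.
- apply dirichlet_poly_monotone; [lra|split].
  + left; apply exp_pos.
  + apply exp_opp_arcosh_le_1, cosh_p_ge_1.
Qed.

Lemma G0_antitone (theta alpha beta : R) :
  0 <= theta <= 1 -> 0 <= alpha <= beta -> beta <= PI ->
  G0 beta theta <= G0 alpha theta.
Proof.
intros ht hab hb; rewrite !G0_eq.
apply dirichlet_poly_monotone; [lra|split].
- apply exp_opp_arcosh_antitone; split; [apply cosh_p_ge_1|].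
  pose proof (cos_decr_1 alpha beta); lra.
- apply exp_opp_arcosh_le_1, cosh_p_ge_1.
Qed.

(** [arcosh] is a choice, so continuity has to come from the closed form of
    [exp (- p alpha)]. *)
Lemma continuous_G0 (theta alpha : R) :
  continuous (fun a => G0 a theta) alpha.
Proof.
apply continuous_ext with
  (fun a => dirichlet_poly theta
              ((2 - cos a) - sqrt ((2 - cos a) ^ 2 - 1))).
{ intros a; rewrite G0_eq; unfold p.
  now rewrite exp_opp_arcosh by apply cosh_p_ge_1. }
apply (continuous_comp (fun a => (2 - cos a) - sqrt ((2 - cos a) ^ 2 - 1))).
- apply (continuous_minus (fun a => 2 - cos a)).
  + apply (ex_derive_continuous (fun a => 2 - cos a)); auto_derive; trivial.
  + apply (continuous_comp (fun a => (2 - cos a) ^ 2 - 1) sqrt).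
    * apply (ex_derive_continuous (fun a => (2 - cos a) ^ 2 - 1)).
      auto_derive; trivial.
    * apply continuous_sqrt.
- apply (ex_derive_continuous (dirichlet_poly theta)).
  unfold dirichlet_poly; auto_derive; trivial.
Qed.

(** * The supremum over the high frequencies *)

Lemma continuous_le_endpoints (h : R -> R) (a b M : R) :
  a < b -> continuous h a -> continuous h b ->
  (forall x, a < x < b -> h x <= M) -> h a <= M /\ h b <= M.
Proof.
intros hab ca cb hM.
split; apply Rnot_lt_le; intros hlt.
- destruct (ca _ (locally_open _ _ (open_gt M) (fun x hx => hx) _ hlt))
    as [d hd].
  assert (hm := Rmin_l d (b - a)); assert (hm' := Rmin_r d (b - a)).
  assert (h0 : 0 < Rmin d (b - a)) by (apply Rmin_pos; [apply cond_pos|lra]).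
  set (x := a + Rmin d (b - a) / 2).
  assert (hx : M < h x).
  { apply hd, Rabs_def1; change (minus x a) with (x - a); unfold x; lra. }
  specialize (hM x); unfold x in *; lra.
- destruct (cb _ (locally_open _ _ (open_gt M) (fun x hx => hx) _ hlt))
    as [d hd].
  assert (hm := Rmin_l d (b - a)); assert (hm' := Rmin_r d (b - a)).
  assert (h0 : 0 < Rmin d (b - a)) by (apply Rmin_pos; [apply cond_pos|lra]).
  set (x := b - Rmin d (b - a) / 2).
  assert (hx : M < h x).
  { apply hd, Rabs_def1; change (minus x b) with (x - b); unfold x; lra. }
  specialize (hM x); unfold x in *; lra.
Qed.

(** Monotonicity of [G0] keeps [1 - dtau * G0] between its values at the two
    ends, which bounds the absolute value; the ends themselves are excluded from
    the interval and are reached by continuity. *)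
Lemma sup_absG_eq (theta dtau : R) :
  0 <= theta <= 1 -> 0 < dtau ->
  sup_absG theta dtau =
  Finite (Rmax (Rabs (1 - dtau * G0 (PI / 2) theta))
               (Rabs (1 - dtau * G0 PI theta))).
Proof.
intros ht hd.
pose proof PI_RGT_0 as hpi.
apply is_lub_Rbar_unique; split.
- intros v [alpha [ha ->]]; simpl; unfold G.
  assert (h1 : G0 alpha theta <= G0 (PI / 2) theta)
    by (apply G0_antitone; lra).
  assert (h2 : G0 PI theta <= G0 alpha theta) by (apply G0_antitone; lra).
  apply RmaxAbs; nra.
- intros [M| |] hM; simpl; trivial.
  + assert (hc : forall a, continuous (fun x => Rabs (G x theta dtau)) a).
    { intros a; apply (continuous_comp (fun x => G x theta dtau) Rabs).
      - unfold G.
        apply (continuous_minus (fun _ => 1)); [apply continuous_const|].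
        apply (continuous_scal_r dtau (fun x => G0 x theta)), continuous_G0.
      - apply continuous_Rabs. }
    destruct (continuous_le_endpoints (fun x => Rabs (G x theta dtau))
                (PI / 2) PI M) as [h1 h2]; auto; [lra| |].
    * intros x hx; apply (hM (Rabs (G x theta dtau))); now exists x.
    * now apply Rmax_lub.
  + apply (hM (Rabs (G (3 * PI / 4) theta dtau))).
    exists (3 * PI / 4); split; [lra|reflexivity].
Qed.

(** * The two-point Chebyshev problem *)

(** For any [t], the maximum [m] satisfies [m >= t * A - 1] and
    [m >= 1 - t * B].  Weighting these by [B] and [A] eliminates [t] and leaves
    [(A + B) * m >= A - B]; when this is an equality, each of the two bounds
    confines [t] to one side of [2 / (A + B)]. *)
Lemma minimax_two_points (A B t : R) :
  0 < B <= A ->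
  let m := fun s => Rmax (Rabs (1 - s * A)) (Rabs (1 - s * B)) in
  (0 < t /\ forall s, 0 < s -> m t <= m s) <-> t = 2 / (A + B).
Proof.
intros hAB m.
assert (hlow : forall s, s * A - 1 <= m s /\ 1 - s * B <= m s).
{ intros s; unfold m; split.
  - apply Rle_trans with (2 := Rmax_l _ _).
    rewrite Rabs_minus_sym; apply Rle_abs.
  - apply Rle_trans with (2 := Rmax_r _ _), Rle_abs. }
assert (hpos : 0 < 2 / (A + B)) by (apply Rdiv_lt_0_compat; lra).
assert (hval : m (2 / (A + B)) = (A - B) / (A + B)).
{ assert (h0 : 0 <= (A - B) / (A + B)) by (apply Rdiv_le_0_compat; lra).
  unfold m.
  replace (1 - 2 / (A + B) * A) with (- ((A - B) / (A + B))) by (field; lra).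
  replace (1 - 2 / (A + B) * B) with ((A - B) / (A + B)) by (field; lra).
  rewrite Rabs_Ropp, Rabs_pos_eq by exact h0.
  now apply Rmax_left, Rle_refl. }
assert (hv : (A + B) * ((A - B) / (A + B)) = A - B) by (field; lra).
assert (ht : (A + B) * (2 / (A + B)) = 2) by (field; lra).
split.
- intros [h0 hmin].
  specialize (hmin _ hpos); rewrite hval in hmin.
  destruct (hlow t) as [h1 h2].
  apply Rmult_eq_reg_l with (A + B); [rewrite ht|lra].
  set (v := (A - B) / (A + B)) in *.
  apply Rle_antisym.
  + apply Rmult_le_reg_l with A; nra.
  + apply Rmult_le_reg_l with B; nra.
- intros ->; split; [exact hpos|].
  intros s hs; rewrite hval.
  destruct (hlow s) as [h1 h2].
  apply Rmult_le_reg_l with (A + B); [lra|].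
  rewrite hv; nra.
Qed.

Theorem proposition1 (theta : R) (htheta : 0 <= theta < 1) (dtau_opt : R) :
  is_argmin (fun dtau => 0 < dtau) (fun dtau => sup_absG theta dtau) dtau_opt
  <-> dtau_opt = 2 / (G0 (PI / 2) theta + G0 PI theta).
Proof.
pose proof PI_RGT_0 as hpi.
assert (hAB : 0 < G0 PI theta <= G0 (PI / 2) theta).
{ split; [now apply G0_pos|apply G0_antitone; lra]. }
rewrite <- (minimax_two_points _ _ dtau_opt hAB).
unfold is_argmin.
split; intros [h0 hmin]; split; trivial; intros s hs; specialize (hmin s hs).
- rewrite !sup_absG_eq in hmin by lra; exact hmin.
- rewrite !sup_absG_eq by lra; exact hmin.
Qed.
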